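(* Let $m\ge 1$ and let $\mu$ be the 2-alternating assignment with $m$ blocks on the $1\times(2m+1)$ strip of stamps. Then the number of valid layer orderings for $\mu$ is $c(\mu)=C_{\lfloor m/2\rfloor+1}\,C_{\lceil m/2\rceil+1}$, where $C_k=\frac{1}{k+1}\binom{2k}{k}$ is the $k$-th Catalan number.
   Context: A $1\times n$ strip of stamps has faces labeled $0,1,\dots,n-1$ from left to right and $n-1$ creases, the crease $(i,i+1)$ lying between faces $i$ and $i+1$. A mountain-valley (MV) assignment is a map $\mu$ from the creases to $\{M,V\}$, written as the word $\mu((0,1))\mu((1,2))\cdots\mu((n-2,n-1))$; $S^k$ denotes the word $S$ repeated $k$ times. The 2-alternating assignment with $m$ blocks is $(M^2V^2)^{m/2}$ for even $m$ and $(M^2V^2)^{(m-1)/2}M^2$ for odd $m$ (a word of length $2m$, hence on a $1\times(2m+1)$ strip). A permutation $\sigma$ of $\{0,\dots,n-1\}$ ($\sigma(i)$ = position of face $i$ in the folded stack, left to right) is a valid layer ordering for $\mu$ if: (1) for each crease $(i,i+1)$, if $\mu((i,i+1))=M$ and $i$ is even, or $\mu((i,i+1))=V$ and $i$ is odd, then $\sigma(i)>\sigma(i+1)$; otherwise $\sigma(i)<\sigma(i+1)$; (2) for any two creases $(i,i+1),(j,j+1)$ with $i\equiv j\pmod 2$, it is not the case that $\sigma(i)<\sigma(j)<\sigma(i+1)<\sigma(j+1)$, nor that this chain holds for any cyclic rotation of the sequence $(\sigma(i),\sigma(j),\sigma(i+1),\sigma(j+1))$. $c(\mu)$ denotes the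 number of valid layer orderings for $\mu$. *)

(* Defs.v *)
From mathcomp Require Import all_boot all_fingroup.
Set Implicit Arguments.
Unset Strict Implicit.
Unset Printing Implicit Defensive.

Inductive mv := Mountain | Valley.

(** A strip with [n] creases has the [n.+1] faces ['I_n.+1]; the crease [(i, i+1)]
    is represented by its left index [i : 'I_n], and an MV assignment is the word
    of its values, of type [n.-tuple mv]. A permutation [s] maps a face to its
    position in the folded stack. *)

Definition left_face n (i : 'I_n) : 'I_n.+1 := widen_ord (leqnSn n) i.
Definition right_face n (i : 'I_n) : 'I_n.+1 := lift ord0 i.

Lemma left_faceE n (i : 'I_n) : left_face i = i :> nat.
Proof. by []. Qed.

Lemma right_faceE n (i : 'I_n) : right_face i = i.+1 :> nat.
Proof. by []. Qed.

Definition crease_decreasing n (mu : n.-tuple mv) (i : 'I_n) : bool :=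
  match tnth mu i with
  | Mountain => ~~ odd i
  | Valley => odd i
  end.

Definition respects_creases n (mu : n.-tuple mv) (s : 'S_n.+1) : bool :=
  [forall i : 'I_n,
     if crease_decreasing mu i
     then s (left_face i) > s (right_face i)
     else s (left_face i) < s (right_face i)].

Definition cyclically_increasing (t : seq nat) : bool :=
  [exists k : 'I_(size t), sorted ltn (rot k t)].

Definition noncrossing n (s : 'S_n.+1) : bool :=
  [forall i : 'I_n, forall j : 'I_n, (odd i == odd j) ==>
     ~~ cyclically_increasing
          [:: val (s (left_face i)); val (s (left_face j));
              val (s (right_face i)); val (s (right_face j))]].

Definition valid_layer_ordering n (mu : n.-tuple mv) (s : 'S_n.+1) : bool :=
  respects_creases mu s && noncrossing s.

Definition num_layer_orderings n (mu : n.-tuple mv) : nat :=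
  #|[set s : 'S_n.+1 | valid_layer_ordering mu s]|.

Definition word_power (w : seq mv) (k : nat) : seq mv := flatten (nseq k w).

Definition two_alternating_word (m : nat) : seq mv :=
  word_power [:: Mountain; Mountain; Valley; Valley] m./2
  ++ (if odd m then [:: Mountain; Mountain] else [::]).

Lemma size_two_alternating_word m : size (two_alternating_word m) == 2 * m.
Proof.
have sizeE k : size (word_power [:: Mountain; Mountain; Valley; Valley] k) = 4 * k.
  by elim: k => //= k IHk; rewrite mulnS -IHk.
rewrite size_cat sizeE -[X in _ == 2 * X]odd_double_half -mul2n mulnDr mulnA addnC.
by case: (odd m).
Qed.

Definition two_alternating (m : nat) : (2 * m).-tuple mv :=
  Tuple (size_two_alternating_word m).

Definition catalan (k : nat) : nat := 'C(2 * k, k) %/ k.+1.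

Lemma mul_catalan k : k.+1 * catalan k = 'C(2 * k, k).
Proof.
rewrite mulnC divnK // -(@Gauss_dvdr _ k) ?coprimeSn //.
have := mul_bin_left (2 * k) k.
by rewrite mul2n -addnn addnK => <-; apply: dvdn_mulr.
Qed.

(* Main.v *)
Require Import Defs.
From mathcomp Require Import all_boot all_fingroup.
From mathcomp Require Import zify.

(** Let [e] be the position of the last face. After an even number of creases,
    mirroring the stack if necessary, the next crease goes to the left above the
    line and the one after it to the right below. An invariant of the region below
    the line that contains the gap just before [e] (see [outer_blocked]) forces
    the next face into that gap, and then the face after it may go to any gap of
    this region on the right. If the region has [i] gaps from [e] on rightwards and
    [j] gaps from [e] on leftwards, the children, after mirroring, have labels
    [(j + 1, l)] for [l = 1, .., i]. The number of descendants after [k] steps is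
    therefore a product of a function of [i] and a function of [j], and both
    factors are ballot numbers. *)

(** * Ballot numbers and Catalan numbers *)

(** Counts the nodes at depth [k] of the Catalan generating tree, in which a node labelled [i] has
    children labelled 2 to [i + 1]. *)
Fixpoint ballot (k i : nat) : nat :=
  if k is k'.+1 then \sum_(l < i) ballot k' l.+2 else 1.

Lemma ballotS k i : ballot k.+1 i.+1 = ballot k.+1 i + ballot k i.+2.
Proof. by rewrite /= big_ord_recr. Qed.

(** The reflection-principle formula, written without subtraction. [ballotS] matches Pascal's rule,
    whence the double induction. *)
Lemma ballot_bin k i :
  ballot k.+1 i + 'C((k + k + i).+1, k) = 'C((k + k + i).+1, k.+1).
Proof.
elim: k i => [|k IHk]; elim=> [|i IHi].
- by rewrite /= big_ord0.
- rewrite ballotS /= addnS !bin0 !bin1 in IHi *; lia.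
(* For [i = 0] the two binomials agree by symmetry, as [k.+1 + k.+2 = 2k + 3]. *)
- rewrite addn0 [ballot _ _]/= big_ord0 add0n.
  by rewrite -[RHS]bin_sub; [congr 'C(_, _); lia | lia].
rewrite ballotS (_ : k.+1 + k.+1 + i.+1 = (k.+1 + k.+1 + i).+1); last by lia.
rewrite [in RHS]binS -IHi [in LHS]binS.
have := IHk i.+2; rewrite (_ : k + k + i.+2 = k.+1 + k.+1 + i); last by lia.
by lia.
Qed.

(** For positive [k], the two binomials of [ballot_bin] have an explicit ratio, and the central
    binomial is twice the larger one. *)
Lemma ballot2 k : ballot k 2 = catalan k.+1.
Proof.
have := mul_catalan k.+1; case: k => [|k] C; first by [].
have B := ballot_bin k 2; have := mul_bin_left (k + k + 2).+1 k.
move: C; rewrite (_ : 2 * k.+2 = (k + k + 2).+2); last by lia.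
rewrite binS (_ : 'C(_, k.+2) = 'C((k + k + 2).+1, k.+1)); last first.
  by rewrite -[RHS]bin_sub; [congr 'C(_, _); lia | lia].
rewrite (_ : (k + k + 2).+1 - k = k.+3); last by lia.
by nia.
Qed.

(** * Stacks, gaps and regions *)

(** A stack is the sequence [p] of the positions of its faces. Gap [g] is the space
    just before position [g]: the face [i] lies to its left iff [nth 0 p i < g]. *)
Definition separates (p : seq nat) (i g : nat) : bool :=
  (nth 0 p i < g) != (nth 0 p i.+1 < g).

(** The gaps lie in one region of the half-plane that carries the creases of parity [b]: each such
    arc covers both or neither. *)
Definition visible (b : bool) (p : seq nat) (g h : nat) : bool :=
  all (fun i => (odd i == b) ==> (separates p i g == separates p i h))
      (iota 0 (size p).-1).

Lemma visibleP b p g h :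
  reflect (forall i, i.+1 < size p -> odd i = b ->
             separates p i g = separates p i h)
          (visible b p g h).
Proof.
apply: (iffP allP) => [vis i ip ib | vis i].
  have := vis i; rewrite mem_iota ib eqxx => /(_ ltac:(lia)) /implyP/(_ isT)/eqP; exact.
rewrite mem_iota => ip; apply/implyP => /eqP ib; apply/eqP/vis => //.
by move: ip; case: (size p) => //=; lia.
Qed.

Definition layering (p : seq nat) : bool :=
  uniq p && all (fun x => x < size p) p.

(** Non-crossing is symmetric in the two creases, so [i < j] is enough. *)
Record folding (d : nat -> bool) (p : seq nat) : Prop := Folding {
  folding_layering : layering p;
  folding_ascends : forall i, i.+1 < size p -> (nth 0 p i < nth 0 p i.+1) = d i;
  folding_noncross : forall i j, i < j -> j.+1 < size p -> odd i = odd j ->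
    separates p i (nth 0 p j) = separates p i (nth 0 p j.+1) }.

(** * Appending one face *)

Definition insert_last (g : nat) (p : seq nat) : seq nat :=
  rcons (map (bump g) p) g.

Lemma size_insert_last g p : size (insert_last g p) = (size p).+1.
Proof. by rewrite size_rcons size_map. Qed.

Lemma nth_insert_last g p i : nth 0 (insert_last g p) i =
  if i < size p then bump g (nth 0 p i) else if i == size p then g else 0.
Proof.
by rewrite nth_rcons size_map; case: ltnP => // ip; rewrite (nth_map 0).
Qed.

Lemma bump_lt g x : (bump g x < g) = (x < g).
Proof. by rewrite /bump; case: leqP; lia. Qed.

Lemma bump_lt2 g x y : (bump g x < bump g y) = (x < y).
Proof. by rewrite !ltnNge leq_bump2. Qed.

Lemma insert_last_inj g g' p p' :
  insert_last g p = insert_last g' p' -> g = g' /\ p = p'.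
Proof.
move=> /rcons_inj[] /[swap] <- E; split=> //.
exact: (inj_map (can_inj (bumpK g)) E).
Qed.

Lemma layering_insert_last g p :
  g <= size p -> layering (insert_last g p) = layering p.
Proof.
move=> gp; rewrite /layering rcons_uniq size_insert_last all_rcons ltnS gp /=.
rewrite map_inj_uniq ?all_map; last exact: can_inj (bumpK g).
rewrite (_ : g \notin _) /=; last first.
  by apply/mapP => -[x _ E]; have := neq_bump g x; rewrite -E eqxx.
congr (_ && _); apply: eq_all => x /=.
by rewrite /bump; case: leqP => /=; lia.
Qed.

Lemma layering_insert_lastP n q : size q = n.+1 -> layering q ->
  exists g p, [/\ q = insert_last g p, size p = n & g <= n].
Proof.
case/lastP: q => // q g; rewrite size_rcons => -[sq] /andP[].
rewrite rcons_uniq all_rcons size_rcons sq => /andP[gq _] /andP[gn _].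
exists g, (map (unbump g) q); split=> //; last by rewrite size_map.
congr rcons; rewrite -map_comp -[LHS]map_id; apply/eq_in_map => x xq /=.
by rewrite unbumpK // inE; apply: contraNneq gq => <-.
Qed.

Lemma nth_lt p i : layering p -> i < size p -> nth 0 p i < size p.
Proof. by case/andP=> _ /(all_nthP 0); apply. Qed.

Lemma nth_neq p i j : layering p -> i < size p -> j < size p -> i != j ->
  nth 0 p i != nth 0 p j.
Proof. by case/andP=> up _ ip jp; rewrite nth_uniq. Qed.

Lemma separates_insert_last g p i : i.+1 < size p ->
  (forall h, separates (insert_last g p) i (bump g h) = separates p i h)
  /\ separates (insert_last g p) i g = separates p i g.
Proof.
move=> ip; rewrite /separates !nth_insert_last ip (ltnW ip).
by split=> [h|]; rewrite ?bump_lt2 ?bump_lt.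
Qed.

(** Only the crease into the new face has to be checked. The gap before face [n] can stand for that
    face, since no earlier crease of the parity of [n] ends there. *)
Lemma folding_insert_last d n g p : size p = n.+1 -> g <= n.+1 ->
  folding d (insert_last g p) <->
  [/\ folding d p, (nth 0 p n < g) = d n & visible (odd n) p g (nth 0 p n)].
Proof.
move=> sp gn; split.
  case=> L D C; rewrite size_insert_last sp in D C.
  have N i : i < n.+1 -> nth 0 (insert_last g p) i = bump g (nth 0 p i).
    by move=> ip; rewrite nth_insert_last sp ip.
  have Nn : nth 0 (insert_last g p) n.+1 = g.
    by rewrite nth_insert_last sp ltnn eqxx.
  split.
  - split; first by rewrite layering_insert_last ?sp in L.
      move=> i; rewrite sp => ip; rewrite -D; last by lia.
      by rewrite !N ?bump_lt2 //; lia.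
    move=> i j ij; rewrite sp => jp oij.
    have [S _] := @separates_insert_last g p i ltac:(lia).
    by have := C i j ij ltac:(lia) oij; rewrite !N ?S //; lia.
  - by rewrite -D // N // Nn bump_lt.
  - apply/visibleP => i; rewrite sp => ip oi.
    have [S Sg] := @separates_insert_last g p i ltac:(lia).
    by have := C i n ip ltac:(lia) oi; rewrite Nn N // S Sg.
case=> -[L D C] E /visibleP V; rewrite sp in D C V.
have N i : i < n.+1 -> nth 0 (insert_last g p) i = bump g (nth 0 p i).
  by move=> ip; rewrite nth_insert_last sp ip.
have Nn : nth 0 (insert_last g p) n.+1 = g.
  by rewrite nth_insert_last sp ltnn eqxx.
split; first by rewrite layering_insert_last ?sp.
  move=> i; rewrite size_insert_last sp => ip.
  have [->|in'] := eqVneq i n; first by rewrite Nn N // bump_lt.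
  by rewrite !N ?bump_lt2 ?D //; lia.
move=> i j ij; rewrite size_insert_last sp => jp oij.
have [S Sg] := @separates_insert_last g p i ltac:(lia).
have [jn|jn] := eqVneq j n.
  by rewrite jn Nn N // S Sg V // -?jn.
have jn1 : j.+1 < n.+1 by rewrite ltn_neqAle eqSS jn.
by rewrite !N ?(ltnW jn1) // !S C.
Qed.

(** * Mirror images *)

Definition flip (p : seq nat) : seq nat := map (fun x => (size p).-1 - x) p.

Lemma size_flip p : size (flip p) = size p.
Proof. exact: size_map. Qed.

Lemma nth_flip p i : i < size p -> nth 0 (flip p) i = (size p).-1 - nth 0 p i.
Proof. by move=> ip; rewrite (nth_map 0). Qed.

Lemma flipK p : layering p -> flip (flip p) = p.
Proof.
case/andP=> _ /allP lp; rewrite /flip size_map -map_comp -[RHS]map_id.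
by apply/eq_in_map => x /lp /=; lia.
Qed.

Lemma layering_flip p : layering p -> layering (flip p).
Proof.
case/andP=> up /allP lp; rewrite /layering map_inj_in_uniq; last first.
  by move=> x y /lp xp /lp yp; lia.
rewrite up; apply/allP => _ /mapP[x /lp xp ->]; rewrite size_flip; lia.
Qed.

Lemma separates_flip p i g : layering p -> i.+1 < size p -> g <= size p ->
  separates (flip p) i g = separates p i (size p - g).
Proof.
move=> L ip gp; rewrite /separates !nth_flip ?(ltnW ip) //.
have := nth_lt _ _ L ip; have := nth_lt _ _ L (ltnW ip).
move: (nth 0 p i) (nth 0 p i.+1) (size p) gp => x y n gp xn yn.
rewrite (_ : (n.-1 - x < g) = ~~ (x < n - g)); last by lia.
rewrite (_ : (n.-1 - y < g) = ~~ (y < n - g)); last by lia.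
by case: (x < _); case: (y < _).
Qed.

Lemma visible_flip b p g h : layering p -> g <= size p -> h <= size p ->
  visible b (flip p) g h = visible b p (size p - g) (size p - h).
Proof.
move=> L gp hp; apply/visibleP/visibleP => V i ip oi; rewrite ?size_flip in ip V *.
  by have := V i ip oi; rewrite !separates_flip.
by rewrite !separates_flip ?V.
Qed.

Lemma folding_flip d p : folding d p -> folding (fun i => ~~ d i) (flip p).
Proof.
case=> L D C; split; first exact: layering_flip.
  move=> i; rewrite size_flip => ip; rewrite -D // !nth_flip ?(ltnW ip) //.
  have := nth_lt _ _ L ip; have := nth_lt _ _ L (ltnW ip).
  have := nth_neq p i i.+1 L (ltnW ip) ip ltac:(lia); lia.
move=> i j ij; rewrite size_flip => jp oij.
have ip : i.+1 < size p by lia.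
have j_lt := nth_lt _ _ L (ltnW jp); have j1_lt := nth_lt _ _ L jp.
rewrite !separates_flip ?nth_flip ?(ltnW jp) //; try lia.
(* Mirroring turns the gap before a face into the gap after it; crease [i] treats both alike unless
   the face is one of its ends. *)
have S x : x < size p -> x != nth 0 p i -> x != nth 0 p i.+1 ->
    separates p i (size p - ((size p).-1 - x)) = separates p i x.
  move=> xp xi xi1; rewrite /separates.
  by rewrite (_ : size p - _ = x.+1) ?ltnS 1?leq_eqVlt; [rewrite 1?leq_eqVlt; lia | lia].
have j_i1 : j != i.+1 by apply: contraTneq isT => ji; move: oij; rewrite ji /=; case: odd.
have [ji j1i j1i1] : [/\ j != i, j.+1 != i & j.+1 != i.+1].
  by clear -ij; split; lia.
have jp' := ltnW jp; have ip' := ltnW ip.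
rewrite (S (nth 0 p j)) ?(S (nth 0 p j.+1)) ?nth_neq //; exact: C.
Qed.

Lemma visible_refl b p g : visible b p g g.
Proof. exact/visibleP. Qed.

Lemma visible_eqr b p g h k : visible b p h k -> visible b p g h = visible b p g k.
Proof.
move=> /visibleP hk; apply/visibleP/visibleP => V i ip oi; first by rewrite V ?hk.
by rewrite V ?hk.
Qed.

(** * The generating tree *)

Definition tip (p : seq nat) : nat := last 0 p.

(** The face after the last one goes into the gap just before the last face, and
    the next one into the gap [h] of [p], which has become gap [h.+1]. *)
Definition grow (h : nat) (p : seq nat) : seq nat :=
  insert_last h.+1 (insert_last (tip p) p).

Definition targets (p : seq nat) : seq nat :=
  [seq h <- index_iota (tip p) (size p).+1 | visible true p h (tip p)].

(** The flip makes the next two creases again go left above and then right below. *)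
Fixpoint foldings (m : nat) : seq (seq nat) :=
  if m is m'.+1 then [seq flip (grow h p) | p <- foldings m', h <- targets p]
  else [:: [:: 0]].

(** [rights] and [lefts] are the labels [i] and [j]; the gap [tip p] counts in both. *)
Definition rights (p : seq nat) : nat := size (targets p).

Definition lefts (p : seq nat) : nat :=
  count (fun g => visible true p g (tip p)) (index_iota 0 (tip p).+1).

(** Creases with an even left face lie above the line, the others below it. *)
Definition outer_blocked (p : seq nat) : Prop :=
  forall g, g <= size p -> visible true p g (tip p) ->
  (g <= tip p -> forall k, k < g -> ~~ visible false p k g) /\
  (tip p < g -> forall k, g < k <= size p -> ~~ visible false p k g).

Lemma tipE n p : size p = n.+1 -> tip p = nth 0 p n.
Proof. by move=> sp; rewrite /tip (last_nth 0) sp; case: p sp. Qed.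

Lemma tip_lt p n : size p = n.+1 -> layering p -> tip p < size p.
Proof. by move=> sp L; rewrite (tipE n) // nth_lt // sp. Qed.

Lemma size_grow h p : size (grow h p) = (size p).+2.
Proof. by rewrite !size_insert_last. Qed.

Lemma nth_grow n h p : size p = n.+1 -> tip p <= h ->
  [/\ forall i, i <= n -> nth 0 (grow h p) i = bump h.+1 (bump (tip p) (nth 0 p i)),
      nth 0 (grow h p) n.+1 = tip p & nth 0 (grow h p) n.+2 = h.+1].
Proof.
move=> sp eh; split=> [i ip||].
- by rewrite !nth_insert_last size_insert_last sp ltnS (leqW ip) ltnS ip.
- rewrite !nth_insert_last size_insert_last sp ltnn eqxx ltnSn /bump.
  by rewrite ltnNge eh.
- by rewrite nth_insert_last size_insert_last sp ltnn eqxx.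
Qed.

(** * Regions after two more faces *)

(** The gap of [p] that contains the gap [G] of [grow h p]. *)
Definition old_gap (e h G : nat) : nat :=
  if G <= e then G else if G <= h.+1 then G.-1 else G.-2.

Lemma bump2_lt e h x G :
  e <= h -> (bump h.+1 (bump e x) < G) = (x < old_gap e h G).
Proof.
rewrite /old_gap /bump => eh.
case: (leqP e x) => ex; case: (leqP G e) => Ge; case: (leqP G h.+1) => Gh;
  case: leqP => hx; lia.
Qed.

Section Grow.
Variables (n h : nat) (p : seq nat).
Hypotheses (sp : size p = n.+1) (en : ~~ odd n) (eh : tip p <= h).

Lemma separates_grow_old i G : i < n ->
  separates (grow h p) i G = separates p i (old_gap (tip p) h G).
Proof.
have [N _ _] := nth_grow n h p sp eh => lt_in.
by rewrite /separates !N ?(ltnW lt_in) // !bump2_lt.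
Qed.

Lemma separates_grow_lower G :
  separates (grow h p) n.+1 G = (tip p < G <= h.+1).
Proof.
have [_ N1 N2] := nth_grow n h p sp eh.
by rewrite /separates N1 N2; lia.
Qed.

Lemma separates_grow_upper G : h = tip p ->
  separates (grow h p) n G = (tip p < G <= h.+2).
Proof.
have [N N1 _] := nth_grow n h p sp eh => he.
rewrite /separates N1 N // -(tipE n) // he /bump leqnn ltnS leqnn; lia.
Qed.

(** The only new arc below joins positions [tip p] and [h.+1]. Gap [h.+2] lies just after the new
    last face, and so just before it once mirrored. *)
Lemma visible_grow_lower G :
  visible true (grow h p) G h.+2 =
  ((G <= tip p) || (h.+2 <= G)) && visible true p (old_gap (tip p) h G) h.
Proof.
have hh : old_gap (tip p) h h.+2 = h.
  by rewrite /old_gap ltnNge (leq_trans eh) ?leqnSn //= ltnn.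
apply/visibleP/andP => [V | [Ge /visibleP V] i].
  split.
    have := V n.+1; rewrite size_grow sp !separates_grow_lower /= en => /(_ _ isT).
    lia.
  apply/visibleP => i; rewrite sp => ip oi.
  by have := V i; rewrite size_grow sp !separates_grow_old // hh => ->; lia.
rewrite size_grow sp !ltnS => ip oi.
have [->|i1] := eqVneq i n.+1; first by rewrite !separates_grow_lower; lia.
have lt_in : i < n.
  have : i != n by apply: contraNneq en => <-.
  by move: ip i1; lia.
by rewrite !separates_grow_old // hh V // sp.
Qed.

(** New creases can only split regions. *)
Lemma visible_grow_upper G K : visible false (grow h p) G K ->
  visible false p (old_gap (tip p) h G) (old_gap (tip p) h K).
Proof.
move=> /visibleP V; apply/visibleP => i; rewrite sp => ip oi.
by rewrite -!separates_grow_old // V // size_grow sp; lia.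
Qed.

Lemma tip_flip_grow : h <= n.+1 -> tip (flip (grow h p)) = n.+1 - h.
Proof.
move=> hn; rewrite (tipE n.+2) ?size_flip ?size_grow ?sp //.
have [_ _ N] := nth_grow n h p sp eh.
by rewrite nth_flip ?size_grow ?sp // N subSS.
Qed.

End Grow.

Lemma layering_grow h p : h <= size p -> tip p <= size p -> layering p ->
  layering (grow h p).
Proof. by move=> hp ep L; rewrite !layering_insert_last ?size_insert_last. Qed.

(** A gap still in the region below comes from a gap of the old region, and what blocked that one
    still blocks it. The exception is [h = tip p]: gap [h.+2] comes from [tip p], which was blocked
    on the left but now needs blocking on the right. There the new upper crease does it. *)
Lemma outer_blocked_flip_grow n h p : size p = n.+1 -> ~~ odd n ->
  tip p <= h <= n.+1 -> visible true p h (tip p) -> layering p ->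
  outer_blocked p -> outer_blocked (flip (grow h p)).
Proof.
move=> sp en /andP[eh hn] vh L B g; rewrite size_flip size_grow sp => gn.
have Lg : layering (grow h p).
  by apply: layering_grow => //; rewrite sp // (leq_trans eh).
rewrite (tip_flip_grow n) // visible_flip ?size_grow ?sp //; last by lia.
rewrite (_ : n.+3 - (n.+1 - h) = h.+2); last by lia.
rewrite (visible_grow_lower n) // (visible_eqr _ _ _ _ _ vh).
set G := n.+3 - g => /andP[GG vG].
have fl k : k <= n.+3 ->
    visible false (flip (grow h p)) k g = visible false (grow h p) (n.+3 - k) G.
  by move=> kn; rewrite visible_flip ?size_grow ?sp.
split=> ge k kg.
  have hG : h.+2 <= G by rewrite /G; lia.
  rewrite fl; last by lia.
  apply/negP => vk; have := visible_grow_upper n h p sp en eh _ _ vk.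
  have kG : G < n.+3 - k <= n.+3 by rewrite /G; lia.
  have oE K : h.+2 <= K -> old_gap (tip p) h K = K.-2.
    by move=> hK; rewrite /old_gap; case: (leqP K (tip p)); case: (leqP K h.+1); lia.
  rewrite oE // in vG *; rewrite oE; last by lia.
  have [Ge|Ge] := eqVneq G.-2 (tip p).
    have he : h = tip p by lia.
    (* The new upper arc covers gap [G = h.+2] and no gap beyond it. *)
    move=> _; move/visibleP: vk => /(_ n); rewrite size_grow sp (negPf en).
    by rewrite !separates_grow_upper // => /(_ ltac:(lia) erefl); lia.
  apply/negP; case: (B G.-2 _ vG) => [|_]; first by lia.
  by rewrite sp; apply; lia.
have Ge : G <= tip p by move: GG; rewrite /G; lia.
rewrite fl; last by lia.
have kG : n.+3 - k < G by rewrite /G; lia.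
apply/negP => /(visible_grow_upper n h p sp en eh); rewrite /old_gap in vG *.
rewrite Ge in vG *; rewrite (leq_trans (ltnW kG) Ge).
apply/negP; case: (B G _ vG) => [|+ _]; first by rewrite sp; lia.
exact.
Qed.

(** The inserted face ends a crease above the line, so the regions below stay the same. *)
Lemma visible_insert_tip n h p : size p = n.+1 -> ~~ odd n -> tip p <= h ->
  visible true (insert_last (tip p) p) h.+1 (tip p) = visible true p h (tip p).
Proof.
move=> sp en eh.
have S i : i < n ->
    separates (insert_last (tip p) p) i h.+1 = separates p i h /\
    separates (insert_last (tip p) p) i (tip p) = separates p i (tip p).
  move=> lt_in; rewrite /separates !nth_insert_last sp !ltnS lt_in (ltnW lt_in).
  rewrite !bump_lt; split=> //.
  have E x : (bump (tip p) x <= h) = (x < h).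
    by rewrite /bump; case: (leqP (tip p) x); lia.
  by rewrite !E.
apply/visibleP/visibleP => V i; rewrite ?size_insert_last sp => ip oi.
  have [<- <-] := S i ip; apply: V => //; rewrite size_insert_last sp; exact: leqW.
have lt_in : i < n.
  by rewrite ltn_neqAle [X in _ && X]ip andbT; apply: contraNneq en => <-; rewrite oi.
by have [-> ->] := S i lt_in; apply: V => //; rewrite sp.
Qed.

Lemma folding_grow d n h p : size p = n.+1 -> ~~ odd n ->
  d n = false -> d n.+1 = true -> tip p <= h <= n.+1 -> folding d p ->
  visible true p h (tip p) -> folding d (grow h p).
Proof.
move=> sp en dn dn1 /andP[eh hn] F vh.
have tn := tipE n p sp.
have en1 : tip p <= n.+1 by exact: leq_trans eh hn.
apply/(folding_insert_last _ n.+1); rewrite ?size_insert_last ?sp //.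
rewrite nth_insert_last sp ltnn eqxx ltnS eh dn1 /= en; split=> //.
  by apply/(folding_insert_last _ n) => //; rewrite -tn ltnn dn visible_refl.
by rewrite (visible_insert_tip n).
Qed.

(** Peel off two faces. The first of them went weakly left of the tip, within its region above, and
    [outer_blocked] at [tip p] excludes every gap further left. *)
Lemma folding_growP d n q : size q = n.+3 -> ~~ odd n ->
  d n = false -> d n.+1 = true ->
  (forall p, size p = n.+1 -> folding d p -> outer_blocked p) ->
  folding d q ->
  exists p h, [/\ size p = n.+1, folding d p, h \in targets p & q = grow h p].
Proof.
move=> sq en dn dn1 B Fq.
have [g2 [p1 [Eq sp1 g2n]]] := layering_insert_lastP _ _ sq (folding_layering _ _ Fq).
move: Fq; rewrite Eq => /(folding_insert_last _ n.+1 _ _ sp1 g2n) [F1].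
have [g1 [p [Ep sp g1n]]] := layering_insert_lastP _ _ sp1 (folding_layering _ _ F1).
move: F1; rewrite Ep => /(folding_insert_last _ n _ _ sp g1n) [F].
rewrite -(tipE n) // nth_insert_last sp ltnn eqxx dn dn1 /= en (negPf en).
move=> /negbT; rewrite -leqNgt => g1e v1 g12 v2.
have g1E : g1 = tip p.
  have := (B p sp F (tip p) _ (visible_refl _ _ _)).
  rewrite ltnW ?(tip_lt _ n) //; last exact: folding_layering F.
  move=> /(_ isT) [/(_ (leqnn _) g1) H _].
  apply/eqP; rewrite eqn_leq g1e leqNgt.
  by apply: contraL v1 => /H.
subst g1; case: g2 g12 g2n v2 Eq => // h; rewrite ltnS => eh hn v2 Eq.
exists p, h; split=> //.
by rewrite mem_filter mem_index_iota eh sp hn -(visible_insert_tip n) // v2.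
Qed.

(** * The tree lists each folding once *)

(** Crease [i] ascends iff [i] is 1 or 2 modulo 4; this is mirrored for odd [m]. *)
Definition ascends (m i : nat) : bool := odd (uphalf i + m).

Lemma ascends_double m : ascends m m.*2 = false.
Proof. by rewrite /ascends uphalf_double addnn odd_double. Qed.

Lemma ascends_doubleS m : ascends m m.*2.+1 = true.
Proof. by rewrite /ascends uphalfE -doubleS doubleK addSn addnn oddS odd_double. Qed.

Lemma size_mem_foldings m p : p \in foldings m -> size p = m.*2.+1.
Proof.
elim: m p => [|m IHm] q; first by rewrite inE => /eqP->.
case/allpairsPdep => p [h] [/IHm sp _ ->].
by rewrite size_flip size_grow sp.
Qed.

Lemma eq_folding d d' p : d =1 d' -> folding d p -> folding d' p.
Proof. by move=> E [L D C]; split=> // i ip; rewrite D. Qed.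

Lemma targets_range p h : h \in targets p ->
  tip p <= h <= size p /\ visible true p h (tip p).
Proof. by rewrite mem_filter mem_index_iota ltnS => /andP[]. Qed.

Lemma foldings_folding m p : p \in foldings m -> folding (ascends m) p /\ outer_blocked p.
Proof.
elim: m p => [|m IHm] q.
  rewrite inE => /eqP->; split; first by split=> // i j; lia.
  (* A single face has only the gaps 0 and 1, and none lies further out. *)
  by move=> g g1 _; split=> g0 k; rewrite /tip /= in g0 *; lia.
case/allpairsPdep => p [h] [pm ht ->].
have [F B] := IHm _ pm; have sp := size_mem_foldings _ _ pm.
have [/andP[eh hn] vh] := targets_range _ _ ht; rewrite sp in hn.
have em : ~~ odd m.*2 by rewrite odd_double.
split; last first.
  by apply: (outer_blocked_flip_grow m.*2); rewrite ?eh //; exact: folding_layering F.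
have Fg : folding (ascends m) (grow h p).
  by apply: (folding_grow _ m.*2); rewrite ?ascends_double ?ascends_doubleS ?eh.
apply: eq_folding (folding_flip _ _ Fg) => i.
by rewrite /ascends addnS.
Qed.

(** By induction the smaller folding is in the list, so it has the property [outer_blocked] that
    [folding_growP] asks for. *)
Lemma mem_foldings m p : size p = m.*2.+1 -> folding (ascends m) p -> p \in foldings m.
Proof.
elim: m p => [|m IHm] q sq F.
  case: q sq F => [|x [|y q]] //= _ [/andP[_ /=]].
  by rewrite andbT ltnS leqn0 => /eqP->.
have Ff : folding (ascends m) (flip q).
  apply: eq_folding (folding_flip _ _ F) => i.
  by rewrite /ascends addnS /= negbK.
have em : ~~ odd m.*2 by rewrite odd_double.
have sf : size (flip q) = m.*2.+3 by rewrite size_flip.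
have [p sp Fp|p [h] [sp Fp ht E]] :=
  folding_growP _ _ _ sf em (ascends_double m) (ascends_doubleS m) _ Ff.
  by case: (foldings_folding m p (IHm _ sp Fp)).
rewrite -(flipK q) ?E; last exact: folding_layering F.
exact: allpairs_f_dep (IHm _ sp Fp) ht.
Qed.

Lemma grow_layering m p h : p \in foldings m -> h \in targets p -> layering (grow h p).
Proof.
move=> pm /targets_range[/andP[eh hn] _].
apply: layering_grow => //; first exact: leq_trans eh hn.
by have [[]] := foldings_folding _ _ pm.
Qed.

Lemma foldings_uniq m : uniq (foldings m).
Proof.
elim: m => // m IHm; apply: allpairs_uniq_dep => //.
  by move=> p _; rewrite filter_uniq // iota_uniq.
move=> _ _ /allpairsPdep[p [h [pm ht ->]]] /allpairsPdep[p' [h' [pm' ht' ->]]] /= E.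
have := flipK _ (grow_layering _ _ _ pm ht).
rewrite E flipK; last exact: grow_layering pm' ht'.
by move=> /insert_last_inj[[->] /insert_last_inj[_ ->]].
Qed.

(** * Counting by labels *)

Lemma count_sub_iota (P : pred nat) N a b : a <= b <= N.+1 ->
  count (fun g => P (N - g)) (index_iota a b) =
  count P (index_iota (N.+1 - b) (N.+1 - a)).
Proof.
case/andP; elim: b => [|b IHb] ab bN.
  by move: ab; rewrite leqn0 => /eqP->; rewrite /index_iota !subnn.
have [->|ab'] := eqVneq a b.+1; first by rewrite /index_iota !subnn.
have ab1 : a <= b by rewrite -ltnS ltn_neqAle ab'.
rewrite /index_iota subSn // -addn1 iotaD count_cat /= subnKC // addn0.
rewrite -/(index_iota a b) IHb //; last exact: ltnW.
rewrite subSS /index_iota.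
rewrite (_ : N.+1 - a - (N - b) = (N.+1 - a - (N.+1 - b)).+1); last by lia.
by rewrite /= -subSn // addnC.
Qed.

(** Before mirroring, the new right gaps are the visible ones up to [h.+2]: the old left gaps and
    [h.+2] itself, as the new arc hides those between. The new left gaps are the old ones from [h]
    on, shifted by two. *)
Lemma labels_flip_grow n h p : size p = n.+1 -> ~~ odd n -> layering p ->
  h \in targets p ->
  rights (flip (grow h p)) = (lefts p).+1 /\
  lefts (flip (grow h p)) =
    count (fun g => visible true p g (tip p)) (index_iota h (size p).+1).
Proof.
move=> sp en L /targets_range[/andP[eh]]; rewrite sp => hn vh.
have Lg : layering (grow h p).
  by apply: layering_grow => //; rewrite sp // (leq_trans eh).
rewrite /rights /lefts size_filter size_flip size_grow sp (tip_flip_grow n) //.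
set P := fun G => visible true (grow h p) G h.+2.
have E a b : b <= n.+4 -> count (fun g => visible true (flip (grow h p)) g (n.+1 - h))
    (index_iota a b) = count (fun g => P (n.+3 - g)) (index_iota a b).
  move=> bn; apply: eq_in_count => g; rewrite mem_index_iota => /andP[_ gb].
  rewrite visible_flip ?size_grow ?sp //; try lia.
  by congr visible; lia.
rewrite !E //; last by lia.
rewrite !count_sub_iota; try lia.
have PE G : P G = ((G <= tip p) || (h.+2 <= G)) &&
    visible true p (old_gap (tip p) h G) (tip p).
  by rewrite /P (visible_grow_lower n) // (visible_eqr _ _ _ _ _ vh).
rewrite subnn (_ : n.+4 - (n.+1 - h) = h.+3); last by lia.
rewrite (_ : n.+4 - (n.+1 - h).+1 = h.+2) ?subn0; last by lia.
split.
  rewrite /index_iota !subn0.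
  (* The three ranges: left of the new arc, under it, and [h.+2]. *)
  rewrite (_ : h.+3 = (tip p).+1 + (h.+1 - tip p) + 1); last by lia.
  rewrite iotaD count_cat [X in X + _](_ : _ =
      count (fun g => visible true p g (tip p)) (iota 0 (tip p).+1)); last first.
    rewrite iotaD count_cat [X in _ + X](_ : _ = 0) ?addn0.
      apply: eq_in_count => g; rewrite mem_iota add0n ltnS => /andP[_ ge].
      by rewrite PE /old_gap ge.
    apply/eqP; rewrite -leqn0 leqNgt -has_count; apply/hasPn => g.
    by rewrite mem_iota PE; lia.
  rewrite (_ : 0 + ((tip p).+1 + _) = h.+2) /= ?addn0; last by lia.
  by rewrite PE leqnn orbT /old_gap (_ : (h.+2 <= tip p) = false) ?ltnn ?vh ?addn1 //; lia.
rewrite /index_iota (_ : n.+4 - h.+2 = n.+2 - h); last by lia.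
rewrite -[h.+2]/(2 + h) iotaDl count_map; apply: eq_in_count => g.
rewrite mem_iota => /andP[hg _] /=; rewrite PE !add2n !ltnS hg orbT.
congr visible; rewrite /old_gap.
by case: (leqP g.+2 (tip p)); case: (leqP g.+2 h.+1); lia.
Qed.

(** As [h] increases through the list, the count from [h] on takes each value from the total down to
    1 once. *)
Lemma sum_filter_suffix (P : pred nat) (f : nat -> nat) N a :
  \sum_(h <- [seq h <- index_iota a N | P h]) f (count P (index_iota h N)) =
  \sum_(l < count P (index_iota a N)) f l.+1.
Proof.
rewrite /index_iota; move E: (N - a) => k.
elim: k a E => [|k IHk] a E; first by rewrite big_nil big_ord0.
rewrite /=; have E1 : N - a.+1 = k by lia.
case Pa: (P a); last by rewrite add0n IHk.
by rewrite big_cons IHk // E /= Pa add1n big_ord_recr /= addnC.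
Qed.

(** The number of descendants after [k] steps. Each step swaps the roles of the labels, so the steps
    act on the two factors in turn, [rights] first. *)
Definition weight (k : nat) (p : seq nat) : nat :=
  ballot (uphalf k) (rights p) * ballot k./2 (lefts p).+1.

Lemma weight_targets n k p : size p = n.+1 -> ~~ odd n -> layering p ->
  \sum_(h <- targets p) weight k (flip (grow h p)) = weight k.+1 p.
Proof.
move=> sp en L; pose P g := visible true p g (tip p).
pose f l := ballot (uphalf k) (lefts p).+1 * ballot k./2 l.+1.
transitivity (\sum_(h <- targets p) f (count P (index_iota h (size p).+1))).
  apply: eq_big_seq => h ht.
  by have [r l] := labels_flip_grow n h p sp en L ht; rewrite /weight r l.
rewrite sum_filter_suffix -size_filter -/(targets p) /f -big_distrr /= mulnC /weight.
by congr (_ * _).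
Qed.

Lemma size_foldings m : size (foldings m) = ballot (uphalf m) 2 * ballot m./2 2.
Proof.
have sum_weight k : \sum_(p <- foldings m) weight k p = weight (m + k) [:: 0].
  elim: m k => [|m IHm] k; first by rewrite big_seq1.
  rewrite addSnnS -IHm big_allpairs_dep; apply: eq_big_seq => p pm.
  apply: (weight_targets m.*2); first exact: size_mem_foldings.
    by rewrite odd_double.
  by have [[]] := foldings_folding _ _ pm.
(* [weight 0] is 1, and the one-face stack has labels 2 and 1, so both ballot arguments are 2. *)
by have := sum_weight 0; rewrite addn0 sum1_size => ->.
Qed.

(** * Permutations as stacks *)

Definition positions {n} (s : 'S_n.+1) : seq nat := [seq val (s i) | i <- enum 'I_n.+1].

Lemma size_positions n (s : 'S_n.+1) : size (positions s) = n.+1.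
Proof. by rewrite size_map size_enum_ord. Qed.

Lemma nth_positions n (s : 'S_n.+1) (i : 'I_n.+1) : nth 0 (positions s) i = s i.
Proof. by rewrite (nth_map i) ?size_enum_ord // nth_ord_enum. Qed.

Lemma positions_inj n : injective (@positions n).
Proof.
move=> s t E; apply/permP => i; apply: val_inj.
by rewrite /= -!nth_positions E.
Qed.

Lemma layering_positions n (s : 'S_n.+1) : layering (positions s).
Proof.
rewrite /layering size_positions map_inj_uniq ?enum_uniq.
  by apply/allP => _ /mapP[i _ ->] /=.
by apply: inj_comp val_inj _; apply: perm_inj.
Qed.

Lemma positions_surj n p : size p = n.+1 -> layering p ->
  exists s : 'S_n.+1, p = positions s.
Proof.
move=> sp L.
have lt_p (i : 'I_n.+1) : nth 0 p i < n.+1.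
  by have := nth_lt p i L; rewrite sp => ->.
pose f i := Ordinal (lt_p i).
have f_inj : injective f.
  move=> i j [] /eqP; rewrite nth_uniq ?sp //; last by case/andP: L.
  by move=> /eqP /val_inj.
exists (perm f_inj); apply: (@eq_from_nth _ 0); rewrite ?size_positions // sp => i ip.
by rewrite -[i]/(val (Ordinal ip)) nth_positions permE.
Qed.

Lemma cyclically_increasing4 a b c d :
  cyclically_increasing [:: a; b; c; d] =
  [|| [&& a < b, b < c & c < d], [&& b < c, c < d & d < a],
      [&& c < d, d < a & a < b] | [&& d < a, a < b & b < c]].
Proof.
apply/existsP/idP => [[[[|[|[|[|k]]]] //= kP]]|].
- by rewrite andbT => ->.
- by rewrite andbT => ->; rewrite orbT.
- by rewrite andbT => ->; rewrite !orbT.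
- by rewrite andbT => ->; rewrite !orbT.
case/or4P => /and3P[ab bc cd].
- by exists (inord 0); rewrite inordK //= ab bc cd.
- by exists (inord 1); rewrite inordK //= /rot /= ab bc cd.
- by exists (inord 2); rewrite inordK //= /rot /= ab bc cd.
- by exists (inord 3); rewrite inordK //= /rot /= ab bc cd.
Qed.

(** Crossing arcs have alternating ends, in one of two cyclic orders; swapping the two creases gives
    the second pattern. *)
Lemma noncrossing_separates (x x' y y' : nat) : uniq [:: x; x'; y; y'] ->
  (((x < y) != (x' < y)) == ((x < y') != (x' < y'))) =
  ~~ cyclically_increasing [:: x; y; x'; y'] &&
  ~~ cyclically_increasing [:: y; x; y'; x'].
Proof. rewrite !cyclically_increasing4 /= !inE; lia. Qed.

Lemma noncrossingP n (s : 'S_n.+1) : reflect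
  (forall i j, i < j -> j.+1 < n.+1 -> odd i = odd j ->
     separates (positions s) i (nth 0 (positions s) j) =
     separates (positions s) i (nth 0 (positions s) j.+1))
  (noncrossing s).
Proof.
pose q := positions s.
have L : layering q := layering_positions _ s.
have sq : size q = n.+1 := size_positions _ s.
have U i j : i < j -> j < n -> odd i = odd j ->
    uniq [:: nth 0 q i; nth 0 q i.+1; nth 0 q j; nth 0 q j.+1].
  move=> ij jn oij; have ij1 : i.+1 != j.
    by apply: contraTneq isT => ji; move: oij; rewrite -ji /=; case: odd.
  rewrite -[X in uniq X]/(map (nth 0 q) [:: i; i.+1; j; j.+1]).
  rewrite map_inj_in_uniq; first by rewrite /= !inE; clear -ij ij1; lia.
  have lt_q k : k \in [:: i; i.+1; j; j.+1] -> k < size q.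
    by rewrite sq !inE; clear -ij jn; lia.
  move=> k l /lt_q kq /lt_q lq /eqP; rewrite nth_uniq //; first by move/eqP.
  by case/andP: L.
have E (i j : 'I_n) : [:: val (s (left_face i)); val (s (left_face j));
    val (s (right_face i)); val (s (right_face j))] =
    [:: nth 0 q i; nth 0 q j; nth 0 q i.+1; nth 0 q j.+1].
  by rewrite /= -!nth_positions.
apply: (iffP idP) => [/forallP C i j ij jn oij | C].
  have i_n : i < n by exact: ltn_trans ij jn.
  have Cij := forallP (C (Ordinal i_n)) (Ordinal (jn : j < n)).
  have Cji := forallP (C (Ordinal (jn : j < n))) (Ordinal i_n).
  move: Cij Cji; rewrite !E /= oij eqxx /= => Cij Cji.
  apply: (elimT eqP); rewrite /separates noncrossing_separates ?Cij //.
  exact: U.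
apply/forallP => i; apply/forallP => j; apply/implyP => /eqP oij; rewrite E.
have CU k l : k < l -> l < n -> odd k = odd l -> _ :=
  fun kl ln okl => etrans (esym (noncrossing_separates _ _ _ _ (U k l kl ln okl)))
     (introT eqP (C k l kl ln okl)).
case: (ltngtP i j) => [ij|ji|/val_inj->].
- by have /andP[] := CU i j ij (ltn_ord j) oij.
- by have /andP[] := CU j i ji (ltn_ord i) (esym oij).
by rewrite cyclically_increasing4; lia.
Qed.

(** Crease [i] is a mountain iff [i./2] is even, so it descends iff [i] and [i./2] have equal
    parity; their parities add up to that of [uphalf i]. *)
Lemma crease_decreasing_two_alternating m (i : 'I_(2 * m)) :
  crease_decreasing (two_alternating m) i = ~~ odd (uphalf i).
Proof.
rewrite /crease_decreasing (tnth_nth Mountain) /=.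
have W k j : j < 4 * k -> nth Mountain
    (word_power [:: Mountain; Mountain; Valley; Valley] k) j =
    if odd j./2 then Valley else Mountain.
  elim: k j => [|k IHk] [|[|[|[|j]]]] //= jk.
  by rewrite IHk ?negbK //; lia.
have sW k : size (word_power [:: Mountain; Mountain; Valley; Valley] k) = 4 * k.
  by elim: k => //= k ->; lia.
have -> : nth Mountain (two_alternating_word m) i =
    if odd i./2 then Valley else Mountain.
  rewrite /two_alternating_word nth_cat sW; case: ltnP => [/W //|mi].
  have im := ltn_ord i.
  (* Beyond the full periods only a final M^2 can remain, where [i./2 = 2 * m./2]. *)
  have -> : odd i./2 = false by lia.
  by case: (odd m) => /=; case: (_ - _) => [|[|[|]]].
rewrite uphalf_half oddD oddb.
by case: (odd i./2); case: (odd i).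
Qed.

Lemma respects_creasesP m (s : 'S_(2 * m).+1) : reflect
  (forall i, i.+1 < (2 * m).+1 ->
     (nth 0 (positions s) i < nth 0 (positions s) i.+1) = ascends 0 i)
  (respects_creases (two_alternating m) s).
Proof.
have El (i : 'I_(2 * m)) : s (left_face i) = nth 0 (positions s) i :> nat.
  by rewrite -nth_positions.
have Er (i : 'I_(2 * m)) : s (right_face i) = nth 0 (positions s) i.+1 :> nat.
  by rewrite -nth_positions.
have D (i : 'I_(2 * m)) : nth 0 (positions s) i != nth 0 (positions s) i.+1.
  by rewrite -El -Er; apply/eqP => /val_inj/perm_inj/(congr1 val) /=; rewrite /bump; lia.
rewrite /ascends; apply: (iffP forallP) => [C i im | C i].
  have := C (Ordinal (im : i < 2 * m)); have := D (Ordinal (im : i < 2 * m)).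
  by rewrite crease_decreasing_two_alternating El Er /= addn0; case: odd => /=; lia.
have := C i (ltn_ord i); have := D i.
by rewrite crease_decreasing_two_alternating El Er /= addn0; case: odd => /=; lia.
Qed.

Lemma valid_layer_orderingP m (s : 'S_(2 * m).+1) : reflect
  (folding (ascends 0) (positions s))
  (valid_layer_ordering (two_alternating m) s).
Proof.
apply: (iffP andP) => [[/respects_creasesP D /noncrossingP C]|[L D C]].
  split; first exact: layering_positions.
    by rewrite size_positions.
  by rewrite size_positions.
rewrite size_positions in D C.
by split; [apply/respects_creasesP | apply/noncrossingP].
Qed.

(** Undoes the net effect of the [m] flips in [foldings m]. *)
Definition mirror (m : nat) (p : seq nat) : seq nat :=
  if odd m then flip p else p.

Lemma size_mirror m p : size (mirror m p) = size p.
Proof. by rewrite /mirror; case: odd; rewrite ?size_flip. Qed.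

Lemma mirrorK m p : layering p -> mirror m (mirror m p) = p.
Proof. by rewrite /mirror; case: odd => //; apply: flipK. Qed.

Lemma folding_mirror k m p :
  folding (ascends k) p -> folding (ascends (k + m)) (mirror m p).
Proof.
rewrite /mirror; case om: (odd m) => F.
  apply: eq_folding (folding_flip _ _ F) => i.
  by rewrite /ascends addnA [RHS]oddD om addbT.
by apply: eq_folding F => i; rewrite /ascends addnA [RHS]oddD om addbF.
Qed.

Theorem theorem3p3 (m : nat) (hm : 1 <= m) :
  num_layer_orderings (two_alternating m) = catalan (m./2).+1 * catalan (uphalf m).+1.
Proof.
rewrite -!ballot2 [RHS]mulnC -size_foldings /num_layer_orderings cardE.
rewrite -(size_map positions) -(size_map (mirror m) (foldings m)).
(* Both lists are free of duplicates and have the same members. *)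
apply/perm_size/uniq_perm.
- by rewrite map_inj_uniq ?enum_uniq //; apply: positions_inj.
- rewrite map_inj_in_uniq ?foldings_uniq // => p q /foldings_folding[[Lp _ _] _].
  by move=> /foldings_folding[[Lq _ _] _] E; rewrite -(mirrorK m p) // E mirrorK.
have dirmm : ascends (m + m) =1 ascends 0 by move=> i; rewrite /ascends addnA oddD addn0; lia.
move=> q; apply/mapP/mapP => [[s + ->] | [p pm ->]].
  rewrite mem_enum inE => /valid_layer_orderingP F.
  exists (mirror m (positions s)); last by rewrite mirrorK ?layering_positions.
  apply: mem_foldings; last exact: (folding_mirror 0).
  by rewrite size_mirror size_positions mul2n.
have [Fp _] := foldings_folding _ _ pm.
have F := eq_folding _ _ _ dirmm (folding_mirror _ m _ Fp).
have sp : size (mirror m p) = (2 * m).+1 by rewrite size_mirror (size_mem_foldings m) // mul2n.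
have [s sE] := positions_surj _ _ sp (folding_layering _ _ F).
exists s => //; rewrite mem_enum inE; apply/valid_layer_orderingP.
by rewrite -sE.
Qed.
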